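(* Let $G$ be a graph. Then every connected induced subgraph of $G$ is dominated by an induced complete split graph (that is, for every connected induced subgraph $F$ of $G$ there is a dominating set $D$ of $F$ such that the induced subgraph $F[D]$ is a complete split graph) if and only if $G$ is $\mathcal{D}$-free, where $\mathcal{D}=\{P_6,C_6,Q_2,Q_5\}$.
   Context: All graphs are finite and simple. $P_\ell$ and $C_\ell$ denote the chordless path and the chordless cycle on $\ell$ vertices. For a set $\mathcal{L}$ of graphs, a graph is $\mathcal{L}$-free if it contains no induced subgraph isomorphic to a member of $\mathcal{L}$. A set $D\subseteq V(F)$ is a dominating set of a graph $F$ if every vertex of $V(F)\setminus D$ is adjacent to some vertex of $D$. A clique (stable set) is a set of mutually adjacent (non-adjacent) vertices. A split graph is a graph whose vertex set can be partitioned into a stable set and a clique. A complete split graph is a split graph where every vertex of the stable set is adjacent to every vertex of the clique. Attaching a leaf to a vertex $u$ of a graph means adding a new vertex $u'$ and the single edge $uu'$. $Q_2$ is the graph obtained from $C_4$ by attaching one leaf to each of its four vertices. The paw is the graph with vertices $a,b,c,d$ and edges $ab,bc,ca,ad$. $Q_5$ is the graph obtained from the paw by attaching one leaf to each of its non-cut vertices $b,c,d$.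
   Formalization: The clique of a complete split graph is required to be nonempty (the stable set may be empty); if it could be empty, every graph, e.g. P_6, would be dominated by a maximal stable set and the ''only if'' direction would fail. *)

(* Defs.v *)
From HB Require Import structures.
From mathcomp Require Import all_boot.

Set Implicit Arguments.
Unset Strict Implicit.
Unset Printing Implicit Defensive.

Record sgraph := SGraph {
  vertex :> finType;
  adj : rel vertex;
  adj_sym : symmetric adj;
  adj_irr : irreflexive adj }.

Arguments adj {_} _ _.

Section Induced.
Variables (G : sgraph) (S : {set G}).

Definition induced_adj : rel {x : G | x \in S} := relpre val adj.

Fact induced_sym : symmetric induced_adj.
Proof. by move=> x y; apply: adj_sym. Qed.

Fact induced_irr : irreflexive induced_adj.
Proof. by move=> x; apply: adj_irr. Qed.

Definition induced : sgraph := SGraph induced_sym induced_irr.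
End Induced.

Definition iso (G H : sgraph) : Prop :=
  exists2 f : G -> H, bijective f & forall x y, adj (f x) (f y) = adj x y.

Definition free (L : sgraph -> Prop) (G : sgraph) : Prop :=
  forall H, L H -> ~ exists S : {set G}, iso (induced S) H.

Definition connected (G : sgraph) : Prop :=
  0 < #|G| /\ forall x y : G, connect adj x y.

Definition dominating (G : sgraph) (D : {set G}) : Prop :=
  forall x : G, x \notin D -> exists2 y, y \in D & adj x y.

Definition stable (G : sgraph) (S : {set G}) : Prop :=
  {in S &, forall x y, ~~ adj x y}.

Definition clique (G : sgraph) (K : {set G}) : Prop :=
  {in K &, forall x y, x != y -> adj x y}.

Definition split_partition (G : sgraph) (S K : {set G}) : Prop :=
  [/\ S :|: K = [set: G], [disjoint S & K], stable S & clique K].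

(* The clique must be nonempty: otherwise every edgeless graph would qualify,
   and every graph is dominated by any of its maximal stable sets.  The stable
   set may be empty, so complete graphs (K_1 included) qualify. *)
Definition complete_split (G : sgraph) : Prop :=
  exists S K : {set G},
    [/\ split_partition S K, K != set0
      & forall x y, x \in S -> y \in K -> adj x y].

Section PathCycle.
Variable n : nat.

Definition path_adj : rel 'I_n :=
  fun i j => (i.+1 == j :> nat) || (j.+1 == i :> nat).

Fact path_sym : symmetric path_adj.
Proof. by move=> i j; rewrite /path_adj orbC. Qed.

Fact path_irr : irreflexive path_adj.
Proof. by move=> i; rewrite /path_adj orbb -[X in _ == X]addn0 -addn1 eqn_add2l. Qed.

Definition path_graph : sgraph := SGraph path_sym path_irr.

(* [ordS] is the cyclic successor; the test [i != j] matters only for n = 1. *)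
Definition cycle_adj : rel 'I_n :=
  fun i j => (i != j) && ((ordS i == j) || (ordS j == i)).

Fact cycle_sym : symmetric cycle_adj.
Proof. by move=> i j; rewrite /cycle_adj eq_sym orbC. Qed.

Fact cycle_irr : irreflexive cycle_adj.
Proof. by move=> i; rewrite /cycle_adj eqxx. Qed.

Definition cycle_graph : sgraph := SGraph cycle_sym cycle_irr.
End PathCycle.

(* One leaf is attached to each vertex of A: the vertex [inr u] is the leaf
   attached to [val u]. *)
Section AttachLeaves.
Variables (G : sgraph) (A : {set G}).

Definition attach_adj : rel (G + {x : G | x \in A})%type :=
  fun u v => match u, v with
  | inl x, inl y => adj x y
  | inl x, inr y => x == val y
  | inr x, inl y => y == val x
  | inr _, inr _ => false
  end.

Fact attach_sym : symmetric attach_adj.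
Proof. by move=> [x|x] [y|y] //=; apply: adj_sym. Qed.

Fact attach_irr : irreflexive attach_adj.
Proof. by move=> [x|x] //=; apply: adj_irr. Qed.

Definition attach_leaves : sgraph := SGraph attach_sym attach_irr.
End AttachLeaves.

(* The vertices a, b, c, d are 0, 1, 2, 3. *)
Definition paw_edges : seq (nat * nat) := [:: (0, 1); (1, 2); (2, 0); (0, 3)].

Definition paw_adj : rel 'I_4 := fun i j =>
  ((i : nat, j : nat) \in paw_edges) || ((j : nat, i : nat) \in paw_edges).

Fact paw_sym : symmetric paw_adj.
Proof. by move=> i j; rewrite /paw_adj orbC. Qed.

Fact paw_irr : irreflexive paw_adj.
Proof. by case=> [[|[|[|[|]]]]]. Qed.

Definition paw : sgraph := SGraph paw_sym paw_irr.

Definition Q2 : sgraph := attach_leaves [set: cycle_graph 4].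

Definition Q5 : sgraph := attach_leaves [set i : paw | (i : 'I_4) != ord0].

Definition forbidden (H : sgraph) : Prop :=
  [\/ H = path_graph 6, H = cycle_graph 6, H = Q2 | H = Q5].

(* Main.v *)
Require Import Defs.
From mathcomp Require Import all_boot.

(** For the main implication, take a complete split set D of a connected
    {P_6, C_6, Q_2, Q_5}-free graph whose closed neighbourhood N[D] is largest. If D does not
    dominate, some w in N[D] outside D has a neighbour outside N[D], and no
    complete split set dominates U = N[D + w]. Among the sets H = (complete
    split set) + w dominating U take a smallest one. Every non-cut vertex x of H
    has a private neighbour x': otherwise H - x would do. Private neighbours of
    the ends of an induced P_4, of the three non-cut vertices of an induced paw
    or of the vertices of an induced C_4 of H would yield P_6, C_6, Q_5 or Q_2,
    unless there are specific edges between the private neighbours. In those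
    cases a part B of H can be traded for a single private neighbour d', which
    gives a set as good as H that is smaller, or of the same size but with d' a
    leaf, and the latter is excluded by the paw argument. *)

Set Implicit Arguments.
Unset Strict Implicit.
Unset Printing Implicit Defensive.

(** * Recognizing the forbidden subgraphs *)

(* Twin-freeness of H makes f injective, so that its injectivity need not be
   checked on the vertices at hand. *)
Lemma free_embedding (L : sgraph -> Prop) (G H : sgraph) (f : H -> G) :
    free L G -> L H -> (forall x y, adj (f x) (f y) = adj x y) ->
    (forall x y : H, (forall z, adj x z = adj y z) -> x = y) -> False.
Proof.
move=> freeG LH fE twinfree; apply: (freeG H LH).
have f_inj : injective f.
  by move=> x y exy; apply: twinfree => z; rewrite -!fE exy.
pose S := [set f x | x : H]; exists S.
have fS x : f x \in S by apply: imset_f.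
have fgP (u : induced S) : exists x, f x == val u.
  by have /imsetP[x _ ->] := valP u; exists x.
pose g u := xchoose (fgP u).
have gK u : f (g u) = val u by apply/eqP/(xchooseP (fgP u)).
exists g; last by move=> u v; rewrite -fE !gK.
exists (fun x => Sub (f x) (fS x)) => [u|x]; first by apply: val_inj; rewrite /= gK.
by apply: f_inj; rewrite gK.
Qed.

Lemma path_cycle_twinfree (H : sgraph) :
    H = path_graph 6 \/ H = cycle_graph 6 ->
  forall x y : H, (forall z, adj x z = adj y z) -> x = y.
Proof.
case=> -> [i lti] [j ltj] E; apply: val_inj => /=;
  move: (E (inord 0)) (E (inord 1)) (E (inord 2)) (E (inord 3)) (E (inord 4))
    (E (inord 5)); rewrite /= /cycle_adj /path_adj -?val_eqE /= !inordK // {E};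
  by move: i j lti ltj => [|[|[|[|[|[|i]]]]]] [|[|[|[|[|[|j]]]]]].
Qed.

(** The pair [x1], [x6] is left free: the six vertices induce C_6 if it is an edge and P_6
    otherwise. This saves a case distinction in every later use. *)
Lemma no_P6_C6 (G : sgraph) (x1 x2 x3 x4 x5 x6 : G) : free forbidden G ->
  adj x1 x2 -> adj x2 x3 -> adj x3 x4 -> adj x4 x5 -> adj x5 x6 ->
  ~~ adj x1 x3 -> ~~ adj x1 x4 -> ~~ adj x1 x5 ->
  ~~ adj x2 x4 -> ~~ adj x2 x5 -> ~~ adj x2 x6 ->
  ~~ adj x3 x5 -> ~~ adj x3 x6 -> ~~ adj x4 x6 -> False.
Proof.
move=> freeG E12 E23 E34 E45 E56.
move=> /negbTE E13 /negbTE E14 /negbTE E15 /negbTE E24 /negbTE E25 /negbTE E26.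
move=> /negbTE E35 /negbTE E36 /negbTE E46.
pose f (i : 'I_6) := nth x1 [:: x1; x2; x3; x4; x5; x6] i.
have [E16|/negbTE E16] := boolP (adj x1 x6).
  apply: (@free_embedding _ _ (cycle_graph 6) f freeG); first by constructor 2.
    case=> [[|[|[|[|[|[|i]]]]]] lti] [[|[|[|[|[|[|j]]]]]] ltj] //;
      by rewrite /f /= /cycle_adj -!val_eqE /= ?adj_irr //; rewrite adj_sym.
  by apply: path_cycle_twinfree; right.
apply: (@free_embedding _ _ (path_graph 6) f freeG); first by constructor 1.
  case=> [[|[|[|[|[|[|i]]]]]] lti] [[|[|[|[|[|[|j]]]]]] ltj] //;
    by rewrite /f /= /path_adj /= ?adj_irr //; rewrite adj_sym.
by apply: path_cycle_twinfree; left.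
Qed.

(** A vertex of [A] is recognized by its own leaf and a leaf by its only neighbour. A vertex outside
    [A] has a neighbour other than any prescribed one, so it is not mistaken for a leaf. *)
Lemma attach_leaves_twinfree (G : sgraph) (A : {set G}) :
    (forall x y : G, x \notin A -> (forall z, adj x z = adj y z) -> x = y) ->
    (forall x y : G, x \notin A -> exists2 z, adj x z & z != y) ->
  forall x y : attach_leaves A, (forall z, adj x z = adj y z) -> x = y.
Proof.
move=> twinA deg2.
have leaf (x : G) (v : {x : G | x \in A}) :
    ~ (forall z : attach_leaves A,
         adj (inl x : attach_leaves A) z = adj (inr v : attach_leaves A) z).
  move=> E; have [xA|xA] := boolP (x \in A).
    by have /= := E (inr (Sub x xA)); rewrite eqxx.
  have [z xz /negbTE zv] := deg2 _ (val v) xA.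
  by have /= := E (inl z); rewrite xz zv.
case=> [x|u] [y|v] E.
- have [xA|xA] := boolP (x \in A).
    by have /= := E (inr (Sub x xA)); rewrite eqxx => /esym/eqP->.
  by congr inl; apply: twinA => // z; apply: (E (inl z)).
- by case: (leaf _ _ E).
- by case: (leaf y u) => z.
- by have /= := E (inl (val u)); rewrite eqxx => /esym/eqP/val_inj->.
Qed.

Lemma no_Q2 (G : sgraph) (a b c d a' b' c' d' : G) : free forbidden G ->
  adj a b -> adj b c -> adj c d -> adj d a -> ~~ adj a c -> ~~ adj b d ->
  adj a a' -> ~~ adj a b' -> ~~ adj a c' -> ~~ adj a d' ->
  ~~ adj b a' -> adj b b' -> ~~ adj b c' -> ~~ adj b d' ->
  ~~ adj c a' -> ~~ adj c b' -> adj c c' -> ~~ adj c d' ->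
  ~~ adj d a' -> ~~ adj d b' -> ~~ adj d c' -> adj d d' ->
  ~~ adj a' b' -> ~~ adj a' c' -> ~~ adj a' d' -> ~~ adj b' c' ->
  ~~ adj b' d' -> ~~ adj c' d' -> False.
Proof.
move=> freeG ab bc cd da /negbTE ac /negbTE bd.
move=> aa' /negbTE ab' /negbTE ac' /negbTE ad'.
move=> /negbTE ba' bb' /negbTE bc' /negbTE bd'.
move=> /negbTE ca' /negbTE cb' cc' /negbTE cd'.
move=> /negbTE da' /negbTE db' /negbTE dc' dd'.
move=> /negbTE a'b' /negbTE a'c' /negbTE a'd' /negbTE b'c' /negbTE b'd' /negbTE c'd'.
pose f (u : Q2) := match u with
  | inl i => nth a [:: a; b; c; d] i
  | inr v => nth a [:: a'; b'; c'; d'] (val v : 'I_4) end.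
apply: (@free_embedding _ _ Q2 f freeG); first by constructor 3.
  case=> [[[|[|[|[|i]]]] lti]|[[[|[|[|[|i]]]] lti] /= iA]]
         [[[|[|[|[|j]]]] ltj]|[[[|[|[|[|j]]]] ltj] /= jA]] //;
      by rewrite /f /= ?/cycle_adj -?val_eqE /= ?adj_irr //; rewrite adj_sym.
by apply: attach_leaves_twinfree => x y; rewrite inE.
Qed.

Lemma no_Q5 (G : sgraph) (a b c d b' c' d' : G) : free forbidden G ->
  adj a b -> adj a c -> adj b c -> adj a d -> ~~ adj b d -> ~~ adj c d ->
  ~~ adj a b' -> ~~ adj a c' -> ~~ adj a d' ->
  adj b b' -> ~~ adj b c' -> ~~ adj b d' ->
  ~~ adj c b' -> adj c c' -> ~~ adj c d' ->
  ~~ adj d b' -> ~~ adj d c' -> adj d d' ->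
  ~~ adj b' c' -> ~~ adj b' d' -> ~~ adj c' d' -> False.
Proof.
move=> freeG ab ac bc ad /negbTE bd /negbTE cd.
move=> /negbTE ab' /negbTE ac' /negbTE ad'.
move=> bb' /negbTE bc' /negbTE bd'.
move=> /negbTE cb' cc' /negbTE cd'.
move=> /negbTE db' /negbTE dc' dd'.
move=> /negbTE b'c' /negbTE b'd' /negbTE c'd'.
pose f (u : Q5) := match u with
  | inl i => nth a [:: a; b; c; d] i
  | inr v => nth a [:: a; b'; c'; d'] (val v : 'I_4) end.
apply: (@free_embedding _ _ Q5 f freeG); first by constructor 4.
  case=> [[[|[|[|[|i]]]] lti]|[[[|[|[|[|i]]]] lti] /= iA]]
         [[[|[|[|[|j]]]] ltj]|[[[|[|[|[|j]]]] ltj] /= jA]] //;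
    try (by move: (iA); rewrite inE); try (by move: (jA); rewrite inE);
      by rewrite /f /= ?/paw_adj -?val_eqE /= ?adj_irr //; rewrite adj_sym.
(* The only vertex of the paw without a leaf is the cut vertex 0. No other vertex is adjacent to all
   of 1, 2 and 3, and 0 has at least two neighbours. *)
apply: attach_leaves_twinfree => x y; rewrite inE negbK => /eqP->.
  move=> E; have := E (inord 1); have := E (inord 2); have := E (inord 3).
  rewrite /= /paw_adj !inordK //=; case: y {E} => [[|[|[|[|i]]]] lti] //= _ _ _.
  exact: val_inj.
have [->|y1] := eqVneq y (inord 1); [exists (inord 2)|exists (inord 1)];
  by rewrite /= /paw_adj 1?eq_sym // -?val_eqE /= !inordK.
Qed.

(** * Closed neighbourhoods and complete split pairs *)

Section ClosedNeighbourhood.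
Variable G : sgraph.
Implicit Types (C S H K B U : {set G}) (x y z : G).

Definition closed_nbh H : {set G} := [set x | (x \in H) || [exists y in H, adj x y]].

Lemma closed_nbhP H x :
  reflect (x \in H \/ exists2 y, y \in H & adj x y) (x \in closed_nbh H).
Proof.
by rewrite inE; apply: (iffP orP) => -[];
  [left|right; apply/exists_inP|left|right; apply/exists_inP].
Qed.

Lemma closed_nbh_subset H K : H \subset K -> closed_nbh H \subset closed_nbh K.
Proof.
move=> /subsetP HK; apply/subsetP=> x /closed_nbhP[/HK xK|[y /HK yK xy]];
  apply/closed_nbhP; [by left|by right; exists y].
Qed.

(** Both parts are subsets of [G] itself, which avoids working in induced subgraphs. The predicate
    is boolean so that the existence of a dominating pair can be decided. Disjointness of the parts
    follows from irreflexivity of adjacency. *)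
Definition complete_split_pair C S : bool :=
  [&& C != set0, [forall x in C, forall y in C, (x != y) ==> adj x y],
      [forall x in S, forall y in S, ~~ adj x y]
    & [forall x in C, forall y in S, adj x y]].

Lemma complete_split_pairP C S :
  reflect [/\ exists x, x \in C, clique C, stable S & {in C & S, forall x y, adj x y}]
          (complete_split_pair C S).
Proof.
apply: (iffP and4P) => -[C0 cC sS CS]; split.
- exact/set0Pn.
- by move=> x y xC yC; move/forall_inP/(_ x xC)/forall_inP/(_ y yC)/implyP: cC.
- by move=> x y xS yS; move/forall_inP/(_ x xS)/forall_inP/(_ y yS): sS.
- by move=> x y xC yS; move/forall_inP/(_ x xC)/forall_inP/(_ y yS): CS.
- exact/set0Pn.
- by apply/forall_inP=> x xC; apply/forall_inP=> y yC; apply/implyP; apply: cC.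
- by apply/forall_inP=> x xS; apply/forall_inP=> y yS; apply: sS.
- by apply/forall_inP=> x xC; apply/forall_inP=> y yS; apply: CS.
Qed.

Lemma complete_split_pair_disjoint C S x :
  complete_split_pair C S -> x \in C -> x \notin S.
Proof.
case/complete_split_pairP=> _ _ _ CS xC; apply/negP=> xS.
by have := CS x x xC xS; rewrite adj_irr.
Qed.

(** Passing to subsets of a given pair allows [C] to be empty: [w] then forms the clique alone. *)
Lemma complete_split_pair_cliqueU1 C0 S0 C S w :
    complete_split_pair C0 S0 -> C \subset C0 -> S \subset S0 ->
    (forall x, x \in C :|: S -> adj w x) ->
  complete_split_pair (w |: C) S.
Proof.
case/complete_split_pairP=> _ cC sS CS /subsetP CC /subsetP SS wadj.
apply/complete_split_pairP; split.
- by exists w; rewrite setU11.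
- move=> x y /setU1P[->|xC] /setU1P[->|yC]; rewrite ?eqxx // => xy.
  + by apply: wadj; rewrite inE yC.
  + by rewrite adj_sym; apply: wadj; rewrite inE xC.
  + by apply: cC => //; apply: CC.
- by move=> x y xS yS; apply: sS; apply: SS.
- move=> x y /setU1P[->|xC] yS; last by apply: CS; [apply: CC|apply: SS].
  by apply: wadj; rewrite inE yS orbT.
Qed.

Lemma complete_split_pair_stableU1 C S w :
    complete_split_pair C S -> (forall x, x \in C -> adj w x) ->
    (forall x, x \in S -> ~~ adj w x) ->
  complete_split_pair C (w |: S).
Proof.
case/complete_split_pairP=> C0 cC sS CS wC wS; apply/complete_split_pairP; split=> //.
- move=> x y /setU1P[->|xS] /setU1P[->|yS]; rewrite ?adj_irr //.
  + exact: wS.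
  + by rewrite adj_sym; apply: wS.
  + exact: sS.
- move=> x y xC /setU1P[->|yS]; last exact: CS.
  by rewrite adj_sym; apply: wC.
Qed.

Lemma complete_split_pair_subset C S C' S' :
    complete_split_pair C S -> C' \subset C -> S' \subset S -> C' != set0 ->
  complete_split_pair C' S'.
Proof.
case/complete_split_pairP=> _ cC sS CS /subsetP CC /subsetP SS /set0Pn C0.
apply/complete_split_pairP; split=> //.
- by move=> x y /CC xC /CC yC; apply: cC.
- by move=> x y /SS xS /SS yS; apply: sS.
- by move=> x y /CC xC /SS yS; apply: CS.
Qed.

Lemma complete_split_pair1 x : complete_split_pair [set x] set0.
Proof.
apply/complete_split_pairP; split.
- by exists x; rewrite set11.
- by move=> y z /set1P-> /set1P->; rewrite eqxx.
- by move=> y z; rewrite inE.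
- by move=> y z _; rewrite inE.
Qed.

Lemma complete_split_pair_dominated_by C S : complete_split_pair C S ->
  exists2 k, k \in C & forall x, x \in C :|: S -> x != k -> adj x k.
Proof.
case/complete_split_pairP=> -[k kC] cC _ CS; exists k => // x.
by rewrite inE => /orP[xC xk|xS _]; [apply: cC|rewrite adj_sym CS].
Qed.

End ClosedNeighbourhood.

(** * Private neighbours *)

Section PrivateNeighbours.
Variables (G : sgraph) (U H : {set G}).
Hypothesis freeG : free forbidden G.
Implicit Types (K B : {set G}) (x y z : G).

Definition private x : {set G} :=
  [set z in U | [&& z \notin H, adj z x & [forall y in H, adj z y ==> (y == x)]]].

Lemma privateP x z :
  reflect [/\ z \in U, z \notin H, adj z x & forall y, y \in H -> y != x -> ~~ adj y z]
          (z \in private x).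
Proof.
rewrite inE; apply: (iffP and4P) => -[zU zH zx Hx]; split=> //.
  move=> y yH; apply: contra => yz; have /forall_inP/(_ y yH)/implyP := Hx.
  by rewrite adj_sym; apply.
apply/forall_inP=> y yH; apply/implyP=> zy; apply/eqP/eqP.
by apply: contraTT zy => yx; rewrite adj_sym Hx.
Qed.

(** Some [z] in [U] is dominated by [H] but no longer by [H :\ x]. It is not [x], which the
    remaining vertex [y] still dominates, so it lies outside [H] and [x] is its only neighbour
    there. *)
Lemma private_exists x y :
    U \subset closed_nbh H -> ~~ (U \subset closed_nbh (H :\ x)) ->
    y \in H -> y != x -> adj x y ->
  exists z, z \in private x.
Proof.
move=> UH /subsetPn[z zU zHx] yH yx xy; exists z.
have zHx' u : u \in H -> u != x -> ~~ adj u z.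
  move=> uH ux; apply: contra zHx; rewrite adj_sym => zu.
  by apply/closed_nbhP; right; exists u; rewrite // !inE ux.
have zx : z != x.
  apply: contra zHx => /eqP->; apply/closed_nbhP; right; exists y => //.
  by rewrite !inE yx.
have zH : z \notin H.
  by apply: contra zHx => zH; apply/closed_nbhP; left; rewrite !inE zx.
have /closed_nbhP[|[u uH zu]] := subsetP UH z zU; first by rewrite (negbTE zH).
have ux : u = x.
  by apply/eqP; apply: contraTT zu => ux; rewrite adj_sym zHx'.
by apply/privateP; split; rewrite // -ux.
Qed.

Lemma private_adj x z : z \in private x -> adj x z.
Proof. by case/privateP=> _ _; rewrite adj_sym. Qed.

Lemma private_nadj x y z :
  z \in private x -> y \in H -> y != x -> ~~ adj y z.
Proof. by case/privateP=> _ _ _; apply. Qed.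

Lemma adj_neq x y : adj x y -> x != y.
Proof. by apply: contraTneq => ->; rewrite adj_irr. Qed.

Lemma neq_of_adj x y z : adj x z -> ~~ adj y z -> x != y.
Proof. by move=> xz; apply: contraNneq => <-. Qed.

(** The vertices a', a, b, c, d, d' form a P_6, or a C_6 if a' and d' are adjacent. *)
Lemma private_P4 a b c d a' d' :
  a \in H -> b \in H -> c \in H -> d \in H ->
  adj a b -> adj b c -> adj c d -> ~~ adj a c -> ~~ adj a d -> ~~ adj b d ->
  a' \in private a -> d' \in private d -> False.
Proof.
move=> aH bH cH dH ab bc cd ac ad bd pa pd.
have [a'b a'c a'd] : [/\ ~~ adj b a', ~~ adj c a' & ~~ adj d a'].
  split; apply: (private_nadj pa) => //; first by rewrite eq_sym adj_neq.
    by rewrite (@neq_of_adj _ _ d) //.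
  by rewrite eq_sym (@neq_of_adj _ _ b) // adj_sym.
have [ad' bd' cd'] : [/\ ~~ adj a d', ~~ adj b d' & ~~ adj c d'].
  split; apply: (private_nadj pd) => //; last exact: adj_neq.
    by rewrite (@neq_of_adj _ _ b) // adj_sym.
  by rewrite (@neq_of_adj _ _ a) // adj_sym.
have [aa' dd'] := (private_adj pa, private_adj pd).
by apply: (@no_P6_C6 G a' a b c d d') => //; rewrite adj_sym.
Qed.

(** Suppose d' and b' are not adjacent. If d' and c' are adjacent, then b', b, a, d, d', c' induce
    P_6 or C_6; otherwise, if b' and c' are adjacent, d', d, a, b, b', c' do so. With no edge among
    b', c', d', the seven vertices induce Q_5. *)
Lemma private_paw a b c d b' c' d' :
  a \in H -> b \in H -> c \in H -> d \in H ->
  adj a b -> adj a c -> adj b c -> adj a d -> ~~ adj d b -> ~~ adj d c ->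
  b' \in private b -> c' \in private c -> d' \in private d -> adj d' b'.
Proof.
move=> aH bH cH dH ab ac bc ad db dc pb pc pd.
have sym := @adj_sym G.
have [nab nac nbc nad] := And4 (adj_neq ab) (adj_neq ac) (adj_neq bc) (adj_neq ad).
have ndb : d != b by rewrite eq_sym (@neq_of_adj _ _ c).
have ndc : d != c by rewrite eq_sym (@neq_of_adj _ _ b) // sym.
have [ab' cb' db'] : [/\ ~~ adj a b', ~~ adj c b' & ~~ adj d b'].
  by split; apply: (private_nadj pb); rewrite // eq_sym.
have [ac' bc' dc'] : [/\ ~~ adj a c', ~~ adj b c' & ~~ adj d c'].
  by split; apply: (private_nadj pc); rewrite // eq_sym.
have [ad' bd' cd'] : [/\ ~~ adj a d', ~~ adj b d' & ~~ adj c d'].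
  by split; apply: (private_nadj pd); rewrite // eq_sym.
have [bb' cc' dd'] := And3 (private_adj pb) (private_adj pc) (private_adj pd).
apply: contraT => d'b'; exfalso.
have [d'c'|d'c'] := boolP (adj d' c').
  by apply: (@no_P6_C6 G b' b a d d' c') => //; rewrite sym.
have [b'c'|b'c'] := boolP (adj b' c').
  by apply: (@no_P6_C6 G d' d a b b' c') => //; rewrite sym.
by apply: (@no_Q5 G a b c d b' c' d') => //; rewrite sym.
Qed.

(** Suppose neither opposite pair is adjacent. An edge between private neighbours of consecutive
    vertices, say a' and b', gives the P_6 or C_6 on c', c, d, a, a', b'. Without such an edge the
    eight vertices induce Q_2. *)
Lemma private_C4 a b c d a' b' c' d' :
  a \in H -> b \in H -> c \in H -> d \in H ->
  adj a b -> adj b c -> adj c d -> adj d a -> a != c -> b != d ->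
  ~~ adj a c -> ~~ adj b d ->
  a' \in private a -> b' \in private b -> c' \in private c -> d' \in private d ->
  adj a' c' || adj b' d'.
Proof.
move=> aH bH cH dH ab bc cd da nac nbd ac bd pa pb pc pd.
have sym := @adj_sym G.
have [nab nbc ncd nda] := And4 (adj_neq ab) (adj_neq bc) (adj_neq cd) (adj_neq da).
have [ba' ca' da'] : [/\ ~~ adj b a', ~~ adj c a' & ~~ adj d a'].
  by split; apply: (private_nadj pa); rewrite // eq_sym.
have [ab' cb' db'] : [/\ ~~ adj a b', ~~ adj c b' & ~~ adj d b'].
  by split; apply: (private_nadj pb); rewrite // eq_sym.
have [ac' bc' dc'] : [/\ ~~ adj a c', ~~ adj b c' & ~~ adj d c'].
  by split; apply: (private_nadj pc); rewrite // eq_sym.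
have [ad' bd' cd'] : [/\ ~~ adj a d', ~~ adj b d' & ~~ adj c d'].
  by split; apply: (private_nadj pd); rewrite // eq_sym.
have [aa' bb' cc' dd'] :=
  And4 (private_adj pa) (private_adj pb) (private_adj pc) (private_adj pd).
apply: contraT => /norP[a'c' b'd']; exfalso.
have [a'b'|a'b'] := boolP (adj a' b').
  by apply: (@no_P6_C6 G c' c d a a' b') => //; rewrite sym.
have [b'c'|b'c'] := boolP (adj b' c').
  by apply: (@no_P6_C6 G d' d a b b' c') => //; rewrite sym.
have [c'd'|c'd'] := boolP (adj c' d').
  by apply: (@no_P6_C6 G a' a b c c' d') => //; rewrite sym.
have [d'a'|d'a'] := boolP (adj d' a').
  by apply: (@no_P6_C6 G b' b c d d' a') => //; rewrite sym.
by apply: (@no_Q2 G a b c d a' b' c' d') => //; rewrite sym.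
Qed.

(* A vertex z left undominated by d' |: K has a neighbour b in B; then
   z - b - a - d - d' - y is an induced P6 or C6 for some private y. *)
Lemma swap_domination K B a d d' : H = K :|: B -> U \subset closed_nbh H ->
  a \in K -> d \in K -> d \notin B -> adj a d ->
  (forall b, b \in B -> adj a b) -> (forall b, b \in B -> ~~ adj d b) ->
  d' \in private d -> (forall b, b \in B -> exists y, y \in private b) ->
  (forall b y, b \in B -> y \in private b -> adj d' y) ->
  U \subset closed_nbh (d' |: K).
Proof.
move=> eH UH aK dK dB ad aB dB' pd pB d'B; apply/subsetP=> z zU.
have sym := @adj_sym G.
have [aH dH] : a \in H /\ d \in H by rewrite eH !inE aK dK.
apply: contraT => zN.
have zK y : y \in d' |: K -> ~~ adj y z.
  move=> yK; apply: contra zN; rewrite sym => zy.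
  by apply/closed_nbhP; right; exists y.
have zd' := zK d' (setU11 _ _).
have za : ~~ adj a z by apply: zK; rewrite inE aK orbT.
have zd : ~~ adj d z by apply: zK; rewrite inE dK orbT.
have zK' : z \notin K.
  by apply: contra zN => zK'; apply/closed_nbhP; left; rewrite inE zK' orbT.
have zB : z \notin B by apply: contra za; apply: aB.
have zH : z \notin H by rewrite eH inE negb_or zK'.
have HB y : y \in H -> adj z y -> y \in B.
  rewrite eH inE => /orP[yK zy|//].
  by have := zK y; rewrite inE yK orbT sym zy => /(_ isT).
have /closed_nbhP[|[b bH zb]] := subsetP UH z zU; first by rewrite (negbTE zH).
have bB := HB b bH zb.
have zNb : z \notin private b by apply: contra zd'; apply: d'B.
(* Since [d'] sees all private neighbours of [b] but not [z], the vertex [z] has a second neighbour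
   [b2], also in [B]. The last vertex of the path is taken private to [b2], hence not adjacent to
   [b]. *)
have /exists_inP[b2 b2H /andP[b2b zb2]] : [exists y in H, (y != b) && adj z y].
  apply: contraR zNb; rewrite negb_exists_in => /forall_inP none.
  apply/privateP; split=> // y yH yb.
  by have := none y yH; rewrite yb /= sym.
have b2B := HB b2 b2H zb2.
have [y py] := pB b2 b2B.
have neB u : u \in B -> u != d by apply: contraTneq => ->.
exfalso; apply: (@no_P6_C6 G z b a d d' y) => //.
- by rewrite sym aB.
- exact: private_adj pd.
- exact: d'B py.
- by rewrite sym.
- by rewrite sym.
- by rewrite sym.
- by rewrite sym dB'.
- by apply: (private_nadj pd) => //; apply: neB.
- by apply: (private_nadj py) => //; rewrite eq_sym.
- by apply: (private_nadj pd) => //; apply: adj_neq.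
- by apply: (private_nadj py) => //; apply: adj_neq; apply: aB.
- by apply: (private_nadj py) => //; rewrite eq_sym; apply: neB.
Qed.

End PrivateNeighbours.

(** * The smallest dominating set of the form complete split set plus a vertex *)

Section MinimalDominatingPair.
Variables (G : sgraph) (U : {set G}) (n : nat).
Hypothesis freeG : free forbidden G.
Hypothesis not_split_dominated :
  forall C S : {set G}, complete_split_pair C S -> ~~ (U \subset closed_nbh (C :|: S)).
Implicit Types (C S K B : {set G}) (x y z w : G).

(** Since [w] lies outside [C :|: S], minimizing [#|C :|: S|] is the same as minimizing the whole
    dominating set. *)
Definition almost_split_dominating C S w : Prop :=
  [/\ complete_split_pair C S, w \notin C :|: S, exists2 x, x \in C :|: S & adj w x
    & U \subset closed_nbh (w |: (C :|: S))].

Hypothesis minimal_n : forall C S w, almost_split_dominating C S w -> n <= #|C :|: S|.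

Lemma private_extra C S w : almost_split_dominating C S w ->
  exists z, z \in private U (w |: (C :|: S)) w.
Proof.
case=> CS wCS [y yCS wy] Udom; apply: (@private_exists _ _ _ _ y) => //.
- by rewrite setU1K ?not_split_dominated.
- by rewrite inE yCS orbT.
- by apply: contraNneq wCS => <-.
Qed.

(** If [x] had no private neighbour, deleting it would contradict minimality: [C :\ x] still
    provides a clique vertex, and [y] keeps [w] attached. *)
Lemma private_in_split C S w x y : almost_split_dominating C S w ->
    #|C :|: S| = n -> x \in C :|: S -> C :\ x != set0 ->
    y \in C :|: S -> y != x -> adj w y ->
  exists z, z \in private U (w |: (C :|: S)) x.
Proof.
case=> CS wCS _ Udom cardn xCS Cx yCS yx wy.
have xw : w != x by apply: contraNneq wCS => ->.
have [c /setD1P[cx cC]] := set0Pn _ Cx.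
apply: (@private_exists _ _ _ _ c) => //; last 1 first.
- move: xCS; case/complete_split_pairP: CS => _ cC' _ CS.
  by rewrite inE => /orP[xC|xS]; [apply: cC' => //; rewrite eq_sym|rewrite adj_sym CS].
- have eD : (w |: (C :|: S)) :\ x = w |: ((C :\ x) :|: (S :\ x)).
    by rewrite -setDUl [LHS]setDUl; congr (_ :|: _); apply/setDidPl; rewrite disjoints1 inE.
  apply/negP => UD.
  have /minimal_n : almost_split_dominating (C :\ x) (S :\ x) w.
    split; rewrite -?eD -?setDUl //.
    + by apply: complete_split_pair_subset CS _ _ Cx; apply: subsetDl.
    + by rewrite inE (negbTE wCS) andbF.
    + by exists y => //; rewrite in_setD1 yx.
  by rewrite -setDUl -cardn (cardsD1 x (C :|: S)) xCS ltnn.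
- by rewrite !inE cC orbT.
Qed.

(** In the trade of [B] for [d'], the new extra vertex [d'] is attached at [d]. The old set has n +
    1 vertices, so the count rules out, by minimality, any trade with two or more vertices in
    [B]. *)
Lemma swap_almost_split C S w CK SK B a d d' :
    almost_split_dominating C S w -> #|C :|: S| = n ->
    complete_split_pair CK SK -> w |: (C :|: S) = (CK :|: SK) :|: B ->
    [disjoint CK :|: SK & B] ->
    a \in CK :|: SK -> d \in CK :|: SK -> adj a d ->
    (forall b, b \in B -> adj a b) -> (forall b, b \in B -> ~~ adj d b) ->
    d' \in private U (w |: (C :|: S)) d ->
    (forall b, b \in B -> exists y, y \in private U (w |: (C :|: S)) b) ->
    (forall b y, b \in B -> y \in private U (w |: (C :|: S)) b -> adj d' y) ->
  almost_split_dominating CK SK d' /\ #|CK :|: SK| + #|B| = n.+1.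
Proof.
move=> [_ wCS _ Udom] cardn CSK eH KB aK dK ad aB dB pd pB d'B; split.
  split=> //.
  - by case/privateP: pd => _; rewrite eH inE negb_or => /andP[].
  - by exists d; rewrite // adj_sym; apply: private_adj pd.
  - apply: (@swap_domination _ _ _ freeG (CK :|: SK) B a d d' eH) => //.
    by rewrite (disjointFr KB dK).
by have := (leq_card_setU (CK :|: SK) B).2; rewrite KB -eH cardsU1 wCS cardn => /eqP.
Qed.

(** An edge inside [B] together with [a] and [d] is a paw, so by [private_paw] the vertex [d'] sees
    every private neighbour of [B]. The trade is then possible, and the edge shows that [B] has at
    least two vertices. *)
Lemma no_paw_partition C S w CK SK B a d :
    almost_split_dominating C S w -> #|C :|: S| = n ->
    complete_split_pair CK SK -> w |: (C :|: S) = (CK :|: SK) :|: B ->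
    [disjoint CK :|: SK & B] ->
    a \in CK :|: SK -> d \in CK :|: SK -> adj a d ->
    (forall b, b \in B -> adj a b) -> (forall b, b \in B -> ~~ adj d b) ->
    B != set0 -> (forall b, b \in B -> exists2 c, c \in B & adj b c) ->
    (exists z, z \in private U (w |: (C :|: S)) d) ->
    (forall b, b \in B -> exists y, y \in private U (w |: (C :|: S)) b) ->
  False.
Proof.
move=> alm cardn CSK eH KB aK dK ad aB dB /set0Pn[b bB] edgeB [d' pd] pB.
have KH x : x \in CK :|: SK -> x \in w |: (C :|: S) by move=> xK; rewrite eH in_setU xK.
have BH x : x \in B -> x \in w |: (C :|: S) by move=> xB; rewrite eH in_setU xB orbT.
have [|/minimal_n leK cardK] :=
    swap_almost_split (d' := d') alm cardn CSK eH KB aK dK ad aB dB pd pB.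
  move=> x x' xB px; have [y yB xy] := edgeB x xB; have [y' py] := pB y yB.
  by apply: (private_paw freeG (a := a) (b := x) (c := y) (d := d)) px py pd; auto.
have [c cB bc] := edgeB b bB.
have : 1 < #|B|.
  by apply/card_gt1P; exists b, c; split=> //; apply: adj_neq.
by move=> B2; have := leq_add leK B2; rewrite cardK addn2 ltnn.
Qed.

(** Paw partition with [w] as pendant vertex: [w] stays with its neighbours in [C], and [B] collects
    all its non-neighbours. The clique vertex [c2] is adjacent to the rest of [B], and [u] ensures
    that this rest is nonempty. *)
Lemma no_pendant C S w c c2 u : almost_split_dominating C S w -> #|C :|: S| = n ->
  (forall s, s \in S -> ~~ adj w s) -> c \in C -> adj w c ->
  c2 \in C -> ~~ adj w c2 -> u \in C :|: S -> u != c2 -> ~~ adj w u -> False.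
Proof.
move=> alm cardn wS cC wc c2C wc2 uCS uc2 wu; have [CS wCS _ _] := alm.
have [_ cC' _ CSadj] := complete_split_pairP _ _ CS.
have CCS x y : x \in C -> y \in C :|: S -> x != y -> adj x y.
  by move=> xC; rewrite inE => /orP[yC|yS] xy; [apply: cC'|apply: CSadj].
pose C1 := [set x in C | adj w x].
pose B := [set x in C :|: S | ~~ adj w x].
have cC1 : c \in C1 by rewrite inE cC.
have CSK : complete_split_pair C1 (w |: set0).
  apply: complete_split_pair_stableU1 => [|x|x]; last by rewrite inE.
    apply: complete_split_pair_subset CS _ (sub0set _) _; last by apply/set0Pn; exists c.
    by apply/subsetP=> x; rewrite inE => /andP[].
  by rewrite inE => /andP[].
have inCS x : x \in C -> x \in C :|: S by rewrite inE => ->.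
apply: (@no_paw_partition C S w C1 (w |: set0) B c w) => //.
- apply/setP=> x; rewrite !inE orbF; have [->|xw] := eqVneq x w; first by rewrite orbT.
  have [xC|xC] := boolP (x \in C); have [wx|wx] := boolP (adj w x) => //=.
    by rewrite andbF; apply/negbTE; apply: contraTN wx => /wS.
  by rewrite andbT.
- rewrite disjoint_subset; apply/subsetP=> x; rewrite !inE orbF => /orP[/andP[_ ->]|/eqP->].
    by rewrite andbF.
  by move: wCS; rewrite inE => /negbTE->.
- by rewrite inE cC1.
- by rewrite !inE eqxx orbT.
- by rewrite adj_sym.
- move=> b; rewrite inE => /andP[bCS wb]; apply: CCS => //.
  by apply: contraNneq wb => <-.
- by move=> b; rewrite inE => /andP[].
- by apply/set0Pn; exists c2; rewrite inE inCS.
- move=> b; rewrite inE => /andP[bCS wb].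
  have [->|bc2] := eqVneq b c2.
    by exists u; [rewrite /B in_set uCS|rewrite CCS // eq_sym].
  by exists c2; [rewrite /B in_set inCS|rewrite adj_sym CCS // eq_sym].
- exact: private_extra alm.
- move=> b; rewrite inE => /andP[bCS wb].
  have cb : c != b by apply: contraNneq wb => <-.
  apply: (@private_in_split C S w b c) => //; last exact: inCS.
  by apply/set0Pn; exists c; rewrite in_setD1 cb.
Qed.

(** If [k] is the whole clique, [w] can join the stable set, giving a complete split set that
    dominates [U]. Otherwise a second clique vertex leads to the configuration of [no_pendant]. *)
Lemma no_leaf C S w k u : almost_split_dominating C S w -> #|C :|: S| = n ->
  k \in C -> adj w k -> (forall x, x \in C :|: S -> x != k -> ~~ adj w x) ->
  u \in S -> False.
Proof.
move=> alm cardn kC wk wCS uS; have [CS _ _ Udom] := alm.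
have SC x : x \in S -> x \notin C.
  by apply: contraTN => /(complete_split_pair_disjoint CS).
have wS x : x \in S -> ~~ adj w x.
  by move=> xS; apply: wCS; [rewrite inE xS orbT|apply: contraNneq (SC _ xS) => ->].
have [C1|[x /setD1P[xk xC]]] := set_0Vmem (C :\ k).
  have eC : C = [set k] by rewrite -(setD1K kC) C1 setU0.
  have/not_split_dominated/negP : complete_split_pair C (w |: S).
    by apply: complete_split_pair_stableU1 => // x; rewrite eC => /set1P->.
  by case; rewrite setUCA.
apply: (no_pendant alm cardn wS kC wk xC _ (u := u)).
- by rewrite wCS // inE xC.
- by rewrite inE uS orbT.
- by apply: contraNneq (SC _ uS) => ->.
- exact: wS.
Qed.

(* Either all private neighbours of w are adjacent to all those of c, or those of
   distinct vertices of S are adjacent: the trade is B = {c} or B = S - s0. *)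
Lemma no_C4_join C S w c s0 t0 :
  almost_split_dominating C S w -> #|C :|: S| = n ->
  (forall s, s \in S -> adj w s) -> c \in C -> ~~ adj w c ->
  (forall x, x \in C -> x != c -> adj w x) ->
  s0 \in S -> t0 \in S -> s0 != t0 -> False.
Proof.
move=> alm cardn wS cC wc wC s0S t0S st; have [CS wCS [v vCS wv] Udom] := alm.
have [_ cC' sS CSadj] := complete_split_pairP _ _ CS.
have [wNC wNS] : w \notin C /\ w \notin S by apply/andP; rewrite -negb_or -in_setU.
have SC x : x \in S -> x \notin C.
  by apply: contraTN => /(complete_split_pair_disjoint CS).
pose H := w |: (C :|: S).
have wH : w \in H by rewrite setU11.
have CH x : x \in C -> x \in H by rewrite !inE => ->; rewrite orbT.
have SH x : x \in S -> x \in H by rewrite !inE => ->; rewrite !orbT.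
have nwc : w != c by apply: contraNneq wNC => ->.
have wCS1 x : x \in (C :\ c) :|: S -> adj w x.
  by rewrite in_setU in_setD1 => /orP[/andP[xc xC]|/wS]; [apply: wC|].
have wCsplit : complete_split_pair (w |: (C :\ c)) S.
  exact: complete_split_pair_cliqueU1 CS (subsetDl _ _) (subxx _) wCS1.
have eH : H = ((w |: (C :\ c)) :|: S) :|: [set c].
  apply/setP=> x; rewrite !inE; have [->|] := eqVneq x c; rewrite ?cC ?orbT //=.
  by rewrite orbF orbA.
have pS s : s \in S -> exists z, z \in private U H s.
  move=> sS'; have [y yS ys] : exists2 y, y \in S & y != s.
    by have [->|] := eqVneq s s0;
      [exists t0; rewrite // eq_sym|exists s0; rewrite // eq_sym].
  apply: (@private_in_split C S w s y) => //; try by rewrite inE ?sS' ?yS orbT.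
    by apply/set0Pn; exists c; rewrite !inE cC andbT; apply: contraNneq (SC _ sS') => <-.
  exact: wS.
(* Without [c], the set [H] is the complete split set of [wCsplit], which cannot dominate [U]. The
   lemma [private_in_split] would need [C :\ c] to be nonempty. *)
have [c' pc] : exists z, z \in private U H c.
  apply: (@private_exists _ _ _ _ s0) => //.
  - apply/negP=> UD; move/not_split_dominated/negP: wCsplit; apply.
    by apply: subset_trans UD _; apply: closed_nbh_subset; rewrite eH setDUl setDv setU0 subsetDl.
  - exact: SH.
  - by apply: contraNneq (SC _ s0S) => ->.
  - exact: CSadj.
have [w' pw] := private_extra alm; rewrite -/H in pw.
(* If some [w1] and [c1] are not adjacent, [private_C4] on the cycle w, s, c, t makes the private
   neighbours of [s] and [t] adjacent. *)
have [/exists_inP[w1 pw1 /exists_inP[c1 pc1 w1c1]]|complete] :=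
  boolP [exists w1 in private U H w, exists c1 in private U H c, ~~ adj w1 c1].
  have Scomplete s t s' t' : s \in S -> t \in S -> s != t ->
      s' \in private U H s -> t' \in private U H t -> adj s' t'.
    move=> sS' tS nst ps pt.
    have := @private_C4 G U H freeG w s c t w1 s' c1 t' wH (SH _ sS') (CH _ cC) (SH _ tS).
    rewrite (negbTE w1c1); apply=> //.
    + exact: wS.
    + by rewrite adj_sym; apply: CSadj.
    + exact: CSadj.
    + by rewrite adj_sym; apply: wS.
    + exact: sS.
  have [s0' ps] := pS s0 s0S.
  (* In the retained part [s0] replaces [c] in the clique, and the nonadjacent vertices [w] and [c]
     become the stable set. *)
  have CSK : complete_split_pair (s0 |: (C :\ c)) (w |: (c |: set0)).
    apply: complete_split_pair_stableU1; first apply: complete_split_pair_stableU1.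
    - apply: complete_split_pair_cliqueU1 CS (subsetDl _ _) (sub0set _) _ => x.
      by rewrite setU0 adj_sym => /setD1P[_ xC]; apply: CSadj.
    - by move=> x /setU1P[->|/setD1P[xc xC]]; [apply: CSadj|apply: cC'; rewrite // eq_sym].
    - by move=> x; rewrite inE.
    - by move=> x /setU1P[->|/setD1P[xc xC]]; [apply: wS|apply: wC].
    - by move=> x; rewrite setU0 => /set1P->.
  have [] := @swap_almost_split C S w (s0 |: (C :\ c)) (w |: (c |: set0)) (S :\ s0)
     w s0 s0' alm cardn CSK.
  - apply/setP=> x; rewrite !inE orbF.
    have [->|xw] := eqVneq x w; rewrite ?orbT //=.
    have [->|xc] := eqVneq x c; rewrite ?cC ?orbT //=.
    by have [->|xs] := eqVneq x s0; rewrite ?s0S ?orbT //= orbF.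
  - rewrite disjoint_sym disjoint_subset; apply/subsetP=> x /setD1P[xs xS].
    rewrite !inE (negbTE xs) (negbTE (SC _ xS)) andbF /= orbF negb_or.
    by apply/andP; split; [apply: contraNneq wNS => <-|apply: contraNneq (SC _ xS) => ->].
  - by rewrite !inE eqxx orbT.
  - by rewrite !inE eqxx.
  - exact: wS.
  - by move=> b /setD1P[_ /wS].
  - by move=> b /setD1P[_ bS]; apply: sS.
  - exact: ps.
  - by move=> b /setD1P[_ /pS].
  - by move=> b y /setD1P[bs bS] py; apply: Scomplete ps py; rewrite // eq_sym.
  (* As [t0] is traded away, the new pair has at most n vertices, hence exactly n. The new extra
     vertex is private to [s0], so it is a leaf. *)
  move=> alm' card'.
  have cardn' : #|(s0 |: C :\ c) :|: (w |: (c |: set0))| = n.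
    apply/eqP; rewrite eqn_leq (minimal_n alm') andbT -ltnS -card' -addn1 leq_add2l.
    by apply/card_gt0P; exists t0; rewrite in_setD1 eq_sym st.
  apply: (no_leaf alm' cardn' (setU11 _ _) _ _ (setU11 _ _)).
    by rewrite adj_sym; apply: private_adj ps.
  move=> x xK xs; rewrite adj_sym; apply: (private_nadj ps) => //.
  move: xK; rewrite !inE orbF (negbTE xs) /= => /orP[/andP[_ ->]|/orP[->//|/eqP->]].
    by rewrite orbT.
  by rewrite cC orbT.
(* Now [w'] sees all private neighbours of [c], so [c] alone can be traded for [w']. The size is
   unchanged and [w'] is a leaf at [w]. *)
have [] := @swap_almost_split C S w (w |: (C :\ c)) S [set c]
  s0 w w' alm cardn wCsplit eH.
- rewrite disjoint_sym disjoints1 !inE eqxx eq_sym (negbTE nwc) /=.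
  by apply: contraTN cC => /SC.
- by rewrite inE s0S orbT.
- by rewrite !inE eqxx.
- by rewrite adj_sym wS.
- by move=> b /set1P->; rewrite adj_sym CSadj.
- by move=> b /set1P->.
- exact: pw.
- by move=> b /set1P->; exists c'.
- move=> b y /set1P-> py; apply: contraNT complete => w'y.
  by apply/exists_inP; exists w' => //; apply/exists_inP; exists y.
rewrite cards1 addn1 => alm' [cardn'].
apply: (no_leaf alm' cardn' (setU11 _ _) _ _ s0S).
  by rewrite adj_sym; apply: private_adj pw.
move=> x xK xw; rewrite adj_sym; apply: (private_nadj pw) => //.
by rewrite -/H eH in_setU xK.
Qed.

Lemma no_almost_split C S w :
  almost_split_dominating C S w -> #|C :|: S| = n -> False.
Proof.
move=> alm cardn; have [CS wCS [v vCS wv] Udom] := alm.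
have [[c0 c0C] cC sS CSadj] := complete_split_pairP _ _ CS.
have [wNC wNS] : w \notin C /\ w \notin S by apply/andP; rewrite -negb_or -in_setU.
have SC x : x \in S -> x \notin C.
  by apply: contraTN => /(complete_split_pair_disjoint CS).
have inC x : x \in C -> x \in C :|: S by rewrite inE => ->.
have inS x : x \in S -> x \in C :|: S by rewrite inE orbC => ->.
have CS_neq x y : x \in C -> y \in S -> x != y.
  by move=> xC yS; apply: contraNneq (SC _ yS) => <-.
have CDS x : x \in S -> C :\ x != set0.
  by move=> xS; apply/set0Pn; exists c0; rewrite in_setD1 c0C CS_neq.
(* The cases depend on which vertices of [S], and then of [C], are missed by [w]. *)
have [/exists_inP[t tS wt]|] := boolP [exists t in S, ~~ adj w t].
  have [/exists_inP[c cC2 wc]|] := boolP [exists c in C, ~~ adj w c].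
    have [/exists_inP[s sS2 ws]|] := boolP [exists s in S, adj w s].
      have [w' pw] := private_extra alm.
      have [t' pt] : exists z, z \in private U (w |: (C :|: S)) t.
        apply: (@private_in_split C S w t s) => //; [exact: inS|exact: CDS|exact: inS|].
        by rewrite (@neq_of_adj _ _ _ w) 1?adj_sym // adj_sym.
      (* The vertices w, s, c, t induce a P_4 with non-cut ends [w] and [t]. *)
      apply: (private_P4 freeG _ _ _ _ ws _ _ wc wt (sS _ _ sS2 tS) pw pt).
      - exact: setU11.
      - by rewrite in_setU inS // orbT.
      - by rewrite in_setU (inC c) // orbT.
      - by rewrite in_setU (inS t) // orbT.
      - by rewrite adj_sym CSadj.
      - exact: CSadj.
    rewrite negb_exists_in => /forall_inP wS.
    have vC : v \in C.
      by move: vCS; rewrite inE => /orP[//|/wS]; rewrite wv.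
    apply: (no_pendant alm cardn wS vC wv cC2 wc (inS _ tS)) => //.
    by rewrite eq_sym CS_neq.
  rewrite negb_exists_in => /forall_inP wC'.
  have wC x : x \in C -> adj w x by move/wC'; rewrite negbK.
  have [/exists_inP[s sS2 ws]|] := boolP [exists s in S, adj w s]; last first.
    rewrite negb_exists_in => /forall_inP wS.
    have/not_split_dominated/negP := complete_split_pair_stableU1 CS wC wS.
    by case; rewrite setUCA.
  have pS x y : x \in S -> y \in C :|: S -> y != x -> adj w y ->
      exists z, z \in private U (w |: (C :|: S)) x.
    by move=> xS yCS yx wy; apply: (@private_in_split C S w x y) => //;
      [exact: inS|exact: CDS].
  (* Here [w] is complete to [C] and mixed on [S]. The part [B] is a star: [w] with its neighbours
     in [S]. The pendant vertex is [t]. *)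
  apply: (@no_paw_partition C S w C [set x in S | ~~ adj w x]
            (w |: [set x in S | adj w x]) c0 t) => //.
  - apply: complete_split_pair_subset CS (subxx _) _ _; last by apply/set0Pn; exists c0.
    by apply/subsetP=> x; rewrite inE => /andP[].
  - apply/setP=> x; rewrite !inE; case: eqP => _; rewrite ?orbT //=.
    by case: (x \in C); case: (x \in S); case: (adj w x).
  - rewrite disjoint_sym disjoint_subset; apply/subsetP=> x /setU1P[->|].
      by rewrite !inE negb_or wNC (negbTE wNS).
    by rewrite !inE => /andP[xS ->]; rewrite andbF orbF SC.
  - by rewrite inE c0C.
  - by rewrite !inE tS wt orbT.
  - exact: CSadj.
  - move=> b /setU1P[->|]; first by rewrite adj_sym wC.
    by rewrite inE => /andP[bS _]; apply: CSadj.
  - move=> b /setU1P[->|]; first by rewrite adj_sym.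
    by rewrite inE => /andP[bS _]; apply: sS.
  - by apply/set0Pn; exists w; rewrite setU11.
  - move=> b /setU1P[->|]; first by exists s; rewrite // !inE sS2 ws orbT.
    by rewrite inE => /andP[bS wb]; exists w; rewrite ?setU11 // adj_sym.
  - apply: (pS t s) => //; first exact: inS.
    by rewrite (@neq_of_adj _ _ _ w) 1?adj_sym // adj_sym.
  - move=> b /setU1P[->|]; first exact: private_extra alm.
    rewrite inE => /andP[bS wb]; apply: (pS b c0) => //;
      [exact: inC|exact: CS_neq|exact: wC].
rewrite negb_exists_in => /forall_inP wS'.
have wS x : x \in S -> adj w x by move/wS'; rewrite negbK.
have [/exists_inP[c cC2 wc]|] := boolP [exists c in C, ~~ adj w c]; last first.
  rewrite negb_exists_in => /forall_inP wC'.
  have wadj x : x \in C :|: S -> adj w x.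
    by rewrite inE => /orP[/wC'|/wS//]; rewrite negbK.
  have/not_split_dominated/negP :=
    complete_split_pair_cliqueU1 CS (subxx _) (subxx _) wadj.
  by case; rewrite -setUA.
have [/exists_inP[c' c'C /andP[c'c wc']]|] :=
  boolP [exists c' in C, (c' != c) && ~~ adj w c'].
  (* The non-neighbours of [w] in [C] form a clique with at least two vertices. They are the part to
     trade, with [w] as pendant vertex. *)
  pose CK := w |: [set x in C | adj w x]; pose B := [set x in C | ~~ adj w x].
  have vK : v \in CK :|: S.
    by move: vCS; rewrite !inE wv andbT => /orP[->|->]; rewrite !orbT.
  apply: (@no_paw_partition C S w CK S B v w) => //.
  - apply: complete_split_pair_cliqueU1 CS _ (subxx _) _.
      by apply/subsetP=> x; rewrite inE => /andP[].
    by move=> x; rewrite !inE => /orP[/andP[]|/wS].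
  - apply/setP=> x; rewrite !inE; case: eqP => _; rewrite ?orbT //=.
    by case: (x \in C); case: (x \in S); case: (adj w x).
  - rewrite disjoint_sym disjoint_subset; apply/subsetP=> x; rewrite !inE => /andP[xC wx].
    rewrite (negbTE wx) andbF orbF negb_or (complete_split_pair_disjoint CS) // andbT.
    by apply: contraNneq wNC => <-.
  - by rewrite !inE eqxx.
  - by rewrite adj_sym.
  - move=> b; rewrite inE => /andP[bC wb]; move: vCS; rewrite inE => /orP[vC|vS].
      by apply: cC => //; apply: contraNneq wb => <-.
    by rewrite adj_sym; apply: CSadj.
  - by move=> b; rewrite inE => /andP[].
  - by apply/set0Pn; exists c; rewrite inE cC2.
  - move=> b; rewrite inE => /andP[bC wb]; have [->|bc] := eqVneq b c.
      by exists c'; [rewrite inE c'C|apply: cC; rewrite // eq_sym].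
    by exists c; [rewrite inE cC2|apply: cC].
  - exact: private_extra alm.
  - move=> b; rewrite inE => /andP[bC wb].
    have vb : v != b by apply: contraNneq wb => <-.
    apply: (@private_in_split C S w b v) => //; first exact: inC.
    have [->|bc] := eqVneq b c; apply/set0Pn.
      by exists c'; rewrite in_setD1 c'c.
    by exists c; rewrite in_setD1 eq_sym bc.
rewrite negb_exists_in => /forall_inP wC'.
have wC x : x \in C -> x != c -> adj w x.
  by move=> /wC'; rewrite negb_and negbK => /orP[/eqP->|]; rewrite ?eqxx ?negbK.
have [/card_gt1P[s [t [sS' tS st]]]|/card_le1P S1] := ltnP 1 #|S|.
  exact: no_C4_join alm cardn wS cC2 wc wC sS' tS st.
(* With at most one vertex, [S] can join the clique [C :\ c]. The stable set {w, c} then completes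
   it, so the whole set is complete split. *)
have CSK : complete_split_pair ((C :\ c) :|: S) set0.
  apply/complete_split_pairP; split; try by move=> x y; rewrite ?inE.
    exists v; move: vCS; rewrite !inE => /orP[vC|->]; rewrite ?orbT //.
    by rewrite vC andbT; apply/orP; left; apply: contraNneq wc => <-.
  move=> x y; rewrite !inE => /orP[/andP[_ xC]|xS] /orP[/andP[_ yC]|yS] xy.
  - exact: cC.
  - exact: CSadj.
  - by rewrite adj_sym; apply: CSadj.
  - by have := S1 x xS y; rewrite yS inE eq_sym (negbTE xy).
have CSKc : complete_split_pair ((C :\ c) :|: S) (c |: set0).
  apply: complete_split_pair_stableU1 CSK _ _ => x; last by rewrite inE.
  rewrite !inE => /orP[/andP[xc xC]|xS]; last exact: CSadj.
  by apply: cC; rewrite // eq_sym.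
have /not_split_dominated/negP : complete_split_pair ((C :\ c) :|: S) (w |: (c |: set0)).
  apply: complete_split_pair_stableU1 CSKc _ _ => x.
    by rewrite !inE => /orP[/andP[xc xC]|/wS//]; apply: wC.
  by rewrite setU0 => /set1P->.
case; suff -> : ((C :\ c) :|: S) :|: (w |: (c |: set0)) = w |: (C :|: S) by [].
apply/setP=> x; rewrite !inE orbF; have [->|] := eqVneq x w; first by rewrite orbT.
by have [->|] := eqVneq x c; rewrite ?cC2 ?orbT ?orbF.
Qed.

End MinimalDominatingPair.

(** * Domination of connected graphs *)

Definition split_dominated (G : sgraph) : Prop :=
  exists C S : {set G}, complete_split_pair C S /\ closed_nbh (C :|: S) = [set: G].

Lemma split_dominatedP (G : sgraph) :
  (exists D : {set G}, dominating D /\ complete_split (induced D)) <-> split_dominated G.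
Proof.
split=> [[D [domD [S [K [[SKT _ sS cK] K0 SK]]]]]|[C [S [CS /setP domCS]]]].
  have CS : complete_split_pair (val @: K) (val @: S).
    apply/complete_split_pairP; split.
    - by have [x xK] := set0Pn _ K0; exists (val x); apply: imset_f.
    - by move=> _ _ /imsetP[x xK ->] /imsetP[y yK ->] xy; apply: cK.
    - by move=> _ _ /imsetP[x xK ->] /imsetP[y yK ->]; apply: (sS x y).
    - by move=> _ _ /imsetP[x xK ->] /imsetP[y yS ->]; rewrite adj_sym; apply: (SK y x).
  have DCS x : x \in D -> x \in val @: K :|: val @: S.
    move=> xD; have : Sub x xD \in S :|: K by rewrite SKT inE.
    by rewrite !inE => /orP[] /(imset_f val)/= ->; rewrite ?orbT.
  exists (val @: K), (val @: S); split=> //; apply/setP=> x; rewrite [RHS]inE.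
  apply/closed_nbhP; have [xD|xD] := boolP (x \in D); first by left; apply: DCS.
  by have [y yD xy] := domD x xD; right; exists y; rewrite // DCS.
have [_ cC sS CSadj] := complete_split_pairP _ _ CS.
exists (C :|: S); split.
  move=> x /negbTE xCS; have := domCS x; rewrite [RHS]inE => /closed_nbhP.
  by rewrite xCS => -[].
exists [set u | val u \in S], [set u | val u \in C]; split.
- split.
  + by apply/setP=> u; rewrite !inE orbC -in_setU (valP u).
  + rewrite disjoint_sym disjoint_subset; apply/subsetP=> u; rewrite !inE.
    exact: complete_split_pair_disjoint.
  + by move=> u v; rewrite !inE; apply: sS.
  + by move=> u v; rewrite !inE -val_eqE; apply: cC.
- have [[c cC'] _ _ _] := complete_split_pairP _ _ CS; apply/set0Pn.
  have cCS : c \in C :|: S by rewrite inE cC'.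
  by exists (Sub c cCS); rewrite inE.
- by move=> u v; rewrite !inE => uS vC; rewrite adj_sym; apply: (CSadj (val v)).
Qed.

(** If no complete split set dominates [U], strong induction on [#|C :|: S|] supplies the minimality
    under which [no_almost_split] is contradictory. *)
Lemma split_dominated_of_almost (G : sgraph) (U C S : {set G}) w :
    free forbidden G -> almost_split_dominating U C S w ->
  exists C' S' : {set G}, complete_split_pair C' S' /\ U \subset closed_nbh (C' :|: S').
Proof.
move=> freeG alm.
have [/existsP[[C' S'] /andP[CS' U']]|none] :=
  boolP [exists p : {set G} * {set G},
           complete_split_pair p.1 p.2 && (U \subset closed_nbh (p.1 :|: p.2))].
  by exists C', S'.
have not_dominated (C' S' : {set G}) :
    complete_split_pair C' S' -> ~~ (U \subset closed_nbh (C' :|: S')).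
  by move=> CS'; apply: contra none => U'; apply/existsP; exists (C', S'); apply/andP.
exfalso; have [n cardn] : exists n, #|C :|: S| = n by exists #|C :|: S|.
elim/ltn_ind: n C S w alm cardn => n IH C S w alm cardn.
have minimal C' S' w' : almost_split_dominating U C' S' w' -> n <= #|C' :|: S'|.
  by move=> alm'; rewrite leqNgt; apply/negP=> /IH/(_ _ _ _ alm' erefl).
exact: (no_almost_split freeG not_dominated minimal alm cardn).
Qed.

Lemma connected_split_dominated (G : sgraph) :
  free forbidden G -> connected G -> split_dominated G.
Proof.
move=> freeG [/card_gt0P[x0 _] conn].
(* Induction on the lower bound [k] replaces the choice of a largest closed neighbourhood: a bound
   above [#|G|] leaves only domination. *)
suff large k : exists C S : {set G}, complete_split_pair C S /\
    (closed_nbh (C :|: S) = setT \/ k <= #|closed_nbh (C :|: S)|).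
  have [C [S [CS [domCS|]]]] := large #|G|.+1; first by exists C, S.
  by rewrite ltnNge max_card.
elim: k=> [|k [C [S [CS [domCS|leN]]]]]; [|by exists C, S; split=> //; left|].
  by exists [set x0], set0; split; [exact: complete_split_pair1|right].
pose N := closed_nbh (C :|: S).
(* If no edge leaves [N], connectedness makes [N] everything. Otherwise [w] extends the pair to a
   set that dominates [N] and also [v], so the pair obtained from it has a strictly larger closed
   neighbourhood. *)
have [/exists_inP[w wN /exists_inP[v vN wv]]|none] :=
  boolP [exists w in N, exists v in ~: N, adj w v]; last first.
  exists C, S; split=> //; left; apply/setP=> x; rewrite [RHS]inE.
  have [[c cC] _ _ _] := complete_split_pairP _ _ CS.
  have clN : closed adj N.
    apply: intro_closed => [|u v uv uN]; first exact: sym_connect_sym (@adj_sym G).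
    apply: contraR none => vN; apply/exists_inP; exists u => //.
    by apply/exists_inP; exists v; rewrite // inE.
  rewrite -/N -(closed_connect clN (conn c x)); apply/closed_nbhP; left.
  by rewrite inE cC.
rewrite inE in vN.
have wCS : w \notin C :|: S.
  apply: contra vN => wCS; apply/closed_nbhP; right; exists w => //.
  by rewrite adj_sym.
have [|[y yCS wy]] := closed_nbhP _ _ wN; first by rewrite (negbTE wCS).
have [//|C' [S' [CS' N']]] := @split_dominated_of_almost G
  (closed_nbh (w |: (C :|: S))) C S w freeG.
  by split=> //; exists y.
exists C', S'; split=> //; right; apply: leq_ltn_trans leN _.
apply: leq_trans (subset_leq_card N').
apply: proper_card; apply/properP; split; first by apply: closed_nbh_subset; apply: subsetUr.
exists v => //; apply/closed_nbhP; right; exists w; first exact: setU11.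
by rewrite adj_sym.
Qed.

(** * Isomorphism and connectedness of the forbidden graphs *)

Lemma iso_split_dominated (F H : sgraph) : iso F H -> split_dominated F -> split_dominated H.
Proof.
case=> f [g fK gK] fE [C [S [CS /setP domCS]]].
have [[c cC] cC' sS CSadj] := complete_split_pairP _ _ CS.
exists (f @: C), (f @: S); split.
  apply/complete_split_pairP; split.
  - by exists (f c); apply: imset_f.
  - move=> _ _ /imsetP[x xC ->] /imsetP[y yC ->]; rewrite (can_eq fK) fE; exact: cC'.
  - by move=> _ _ /imsetP[x xC ->] /imsetP[y yC ->]; rewrite fE; apply: sS.
  - by move=> _ _ /imsetP[x xC ->] /imsetP[y yC ->]; rewrite fE; apply: CSadj.
apply/setP=> x; rewrite [RHS]inE -imsetU; apply/closed_nbhP; rewrite -[x]gK.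
have := domCS (g x); rewrite [RHS]inE => /closed_nbhP[xCS|[y yCS xy]].
  by left; apply: imset_f.
by right; exists (f y); [apply: imset_f|rewrite fE].
Qed.

(* A certificate of connectedness that is easy to build and to transport. *)
Definition ranked (G : sgraph) : Prop :=
  exists (r : G) (rk : G -> nat), forall x, x != r -> exists2 y, adj x y & rk y < rk x.

Lemma ranked_connected (G : sgraph) : ranked G -> connected G.
Proof.
case=> r [rk desc]; have csym := sym_connect_sym (@adj_sym G).
have to_root x : connect adj x r.
  have [m] := ubnP (rk x); elim: m x => // m IH x; rewrite ltnS => lem.
  have [->|/desc[y xy ltyx]] := eqVneq x r; first exact: connect0.
  by apply: connect_trans (connect1 xy) (IH y _); apply: leq_trans lem.
split; first by apply/card_gt0P; exists r.
by move=> x y; apply: connect_trans (to_root x) _; rewrite csym.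
Qed.

Lemma iso_ranked (F H : sgraph) : iso F H -> ranked H -> ranked F.
Proof.
case=> f [g fK gK] fE [r [rk desc]]; exists (g r), (rk \o f) => x xr.
have [|y xy lt] := desc (f x); first by rewrite -(can2_eq fK gK) in xr *.
by exists (g y); rewrite /= -?fE ?gK.
Qed.

Lemma attach_leaves_ranked (G : sgraph) (A : {set G}) : ranked G -> ranked (attach_leaves A).
Proof.
case=> r [rk desc]; pose rk' (u : attach_leaves A) :=
  match u with inl x => rk x | inr v => (rk (val v)).+1 end.
exists (inl r), rk' => -[x|v] xr; last by exists (inl (val v)); rewrite /= ?eqxx.
have [|y xy lt] := desc x; first by apply: contraNneq xr => ->.
by exists (inl y).
Qed.

Lemma path_cycle_ranked (H : sgraph) n :
  H = path_graph n.+1 \/ H = cycle_graph n.+1 -> ranked H.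
Proof.
case=> ->; exists ord0, val => -[[|i] lti] // _; exists (Ordinal (ltnW lti)) => //=.
  by rewrite /path_adj /= eqxx orbT.
by rewrite /cycle_adj -!val_eqE /= [i.+1 %% _]modn_small // eqxx orbT andbT gtn_eqF.
Qed.

Lemma paw_ranked : ranked paw.
Proof.
exists (ord0 : 'I_4), (val : 'I_4 -> nat) => -[[|[|[|[|i]]]] lti] // _;
  by exists (ord0 : 'I_4).
Qed.

Lemma forbidden_ranked (H : sgraph) : forbidden H -> ranked H.
Proof.
case=> ->; [apply: (@path_cycle_ranked _ 5)|apply: (@path_cycle_ranked _ 5)|..]; auto.
  by apply: attach_leaves_ranked; apply: (@path_cycle_ranked _ 3); auto.
exact/attach_leaves_ranked/paw_ranked.
Qed.

(** * The forbidden graphs are not dominated by a complete split graph *)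

Lemma complete_split_pair_center (G : sgraph) (C S : {set G}) :
    complete_split_pair C S -> closed_nbh (C :|: S) = setT ->
  exists k, forall x, exists y,
    [/\ y \in C :|: S, y = x \/ adj x y & y = k \/ adj y k].
Proof.
move=> CS /setP domCS; have [k kC kD] := complete_split_pair_dominated_by CS.
exists k => x; have := domCS x; rewrite [RHS]inE => /closed_nbhP xN.
have near_k y : y \in C :|: S -> y = k \/ adj y k.
  by move=> yCS; have [|/(kD y yCS)] := eqVneq y k; [left|right].
case: xN => [xCS|[y yCS xy]]; first by exists x; split; auto.
by exists y; split; auto.
Qed.

(** A clique vertex of a dominating complete split set is within distance two of every vertex. Hence
    it suffices that each vertex has another one at distance at least three. *)
Lemma not_split_dominated_radius (G : sgraph) :
    (forall k : G, exists x, [/\ x != k, ~~ adj x k & forall y, ~~ (adj x y && adj y k)]) ->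
  ~ split_dominated G.
Proof.
move=> far [C [S [CS domCS]]]; have [k near] := complete_split_pair_center CS domCS.
have [x [/eqP xk /negP xk' xyk]] := far k.
have [y [_ [->|xy] [yk|yk]]] := near x; rewrite -?yk // in xk' *.
by have := xyk y; rewrite xy yk.
Qed.

Lemma path6_not_split_dominated : ~ split_dominated (path_graph 6).
Proof.
apply: not_split_dominated_radius => -[k ltk].
(* The far vertex is the end of the path on the other side. *)
exists (if k < 3 then @Ordinal 6 5 isT else @Ordinal 6 0 isT).
case: k ltk => [|[|[|[|[|[|k]]]]]] ltk //; split=> // -[y lty];
  by case: y lty => [|[|[|[|[|[|y]]]]]].
Qed.

Lemma cycle6_not_split_dominated : ~ split_dominated (cycle_graph 6).
Proof.
apply: not_split_dominated_radius => -[k ltk].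
(* The far vertex is the antipode of [k]. *)
exists (Ordinal (ltn_pmod (k + 3) (isT : 0 < 6))).
case: k ltk => [|[|[|[|[|[|k]]]]]] ltk //; split=> // -[y lty];
  by case: y lty => [|[|[|[|[|[|y]]]]]].
Qed.

Lemma Q2_not_split_dominated : ~ split_dominated Q2.
Proof.
apply: not_split_dominated_radius => k.
pose i : 'I_4 := match k with inl i => i | inr v => val v end.
(* The far vertex is the leaf at the cycle vertex opposite to [k], or to the vertex where the leaf
   [k] is attached. *)
pose j : cycle_graph 4 := Ordinal (ltn_pmod (i + 2) (isT : 0 < 4)).
have jT : j \in [set: cycle_graph 4] by rewrite inE.
exists (inr (Sub j jT)); rewrite {}/j {}/i in jT *.
case: k jT => [[[|[|[|[|k]]]] ltk]|[[[|[|[|[|k]]]] ltk] kT]] //= jT;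
  split=> // -[[y lty]|u] //;
  by case: y lty => [|[|[|[|y]]]].
Qed.

(** The radius is two here, but only the cut vertex of the paw can be the centre. Reaching the three
    leaves from it in two steps puts b, c and d into the dominating set. As d is adjacent to neither
    b nor c, both of these lie in the stable set, although they are adjacent. *)
Lemma Q5_not_split_dominated : ~ split_dominated Q5.
Proof.
case=> C [S [CS domCS]]; have [k near] := complete_split_pair_center CS domCS.
have [_ cC sS CSadj] := complete_split_pairP _ _ CS.
have cut (i : 'I_4) : i != ord0 -> i \in [set i : paw | (i : 'I_4) != ord0].
  by rewrite inE.
have [i iE] : exists i : 'I_4, i = match k with inl i => i | inr v => val v end by eexists.
have [i0|i0] := eqVneq i ord0; last first.
  (* A non-cut vertex [j] of the paw not adjacent to [i]: its leaf is at distance at least three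
     from [k]. *)
  pose j : paw := if i == 3 :> nat then @Ordinal 4 1 isT else @Ordinal 4 3 isT.
  have jA : (j : 'I_4) != ord0 by rewrite /j; case: ifP.
  have [ji nji] : j != i /\ ~~ paw_adj j i.
    by rewrite /j; case: (i) i0 => [[|[|[|[|m]]]] ltm].
  pose leaf : Q5 := inr (Sub j (cut _ jA)).
  have [y [_ yx yk]] := near leaf.
  have yE : y = leaf \/ y = inl j.
    case: yx => [|]; first by left.
    by case: y {yk} => //= y /eqP->; right.
  case: k {near} iE yk => [k|v] /= ei.
    rewrite -ei; case: yE => -> [] // => [/eqP ek|[ek]|jk].
    - by rewrite ek eqxx in ji.
    - by rewrite ek eqxx in ji.
    - by case/negP: nji.
  by case: yE => -> [] //= => [[ek]|/eqP ek]; rewrite ei -ek ?SubK eqxx in ji.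
have kE : k = inl (ord0 : 'I_4).
  case: k iE {near} => [k|v] /= ei; first by rewrite -ei i0.
  by have := valP v; rewrite inE => /eqP[]; exact: etrans (esym ei) i0.
have inD (j : 'I_4) : j != ord0 -> (inl j : Q5) \in C :|: S.
  move=> j0; have [y [yCS yx yk]] := near (inr (Sub j (cut _ j0))).
  suff -> : inl j = y :> Q5 by [].
  rewrite kE in yk; case: yx => [ey|].
    rewrite ey in yk; case: yk => //= /eqP ej; case/eqP: (j0); exact: esym ej.
  by case: y {yCS yk} => //= y /eqP->.
pose b : 'I_4 := @Ordinal 4 1 isT; pose c : 'I_4 := @Ordinal 4 2 isT.
pose d : 'I_4 := @Ordinal 4 3 isT.
have := inD d isT; have := inD b isT; have := inD c isT; rewrite !inE.
have CD x y : x \in C -> y \in C :|: S -> x != y -> adj x y.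
  by move=> xC; rewrite inE => /orP[yC|yS] xy; [apply: cC|apply: CSadj].
have dD := inD d isT.
case/orP=> [cC'|cS]; first by have := CD _ _ cC' dD isT.
case/orP=> [bC|bS]; first by have := CD _ _ bC dD isT.
by have := sS _ _ bS cS.
Qed.

Lemma forbidden_not_split_dominated (H : sgraph) : forbidden H -> ~ split_dominated H.
Proof.
case=> ->; [exact: path6_not_split_dominated|exact: cycle6_not_split_dominated|
  exact: Q2_not_split_dominated|exact: Q5_not_split_dominated].
Qed.

(** * Induced subgraphs of induced subgraphs and the equivalence *)

Lemma iso_trans (F G H : sgraph) : iso F G -> iso G H -> iso F H.
Proof.
case=> f bf fE [g bg gE]; exists (g \o f); first exact: bij_comp.
by move=> x y; rewrite /= gE fE.
Qed.

Lemma induced_induced (G : sgraph) (X : {set G}) (Y : {set induced X}) :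
  iso (induced (val @: Y)) (induced Y).
Proof.
have inX u : u \in val @: Y -> u \in X by case/imsetP=> v _ ->; apply: valP.
have inY u (uY : u \in val @: Y) : (Sub u (inX u uY) : induced X) \in Y.
  have /imsetP[v vY ev] := uY; suff -> : Sub u (inX u uY) = v by [].
  by apply: val_inj.
exists (fun u => Sub (Sub (val u) (inX _ (valP u))) (inY _ (valP u))) => //.
exists (fun v : induced Y => Sub (val (val v)) (imset_f val (valP v))) => u.
  by apply: val_inj.
by do 2!apply: val_inj.
Qed.

Lemma free_induced (L : sgraph -> Prop) (G : sgraph) (X : {set G}) :
  free L G -> free L (induced X).
Proof.
move=> freeG H LH [Y isoY]; apply: (freeG H LH); exists (val @: Y).
exact: iso_trans (induced_induced Y) isoY.
Qed.

Theorem theorem3p2 (G : sgraph) :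
  (forall X : {set G}, connected (induced X) ->
     exists D : {set induced X}, dominating D /\ complete_split (induced D))
  <-> free forbidden G.
Proof.
split=> [dom H forbH [X isoX]|freeG X conn]; last first.
  apply/split_dominatedP; apply: connected_split_dominated conn.
  exact: free_induced.
apply: (forbidden_not_split_dominated forbH); apply: (iso_split_dominated isoX).
apply/split_dominatedP/dom/ranked_connected.
exact: iso_ranked isoX (forbidden_ranked forbH).
Qed.
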